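(* Let $\lambda>0$ and let $f:\mathbb{R}\times\{\pm1\}\to\mathbb{C}$ be such that $f(\cdot,1)$ and $f(\cdot,-1)$ are $C_0$, i.e. continuous with $\lim_{y\to\pm\infty}|f(y,\pm1)|=0$. For every $\epsilon>0$ let $\psi_0^\epsilon(x,z)=f(\epsilon x,z)$ for $(x,z)\in\mathbb{Z}\times\{\pm1\}$, assumed to define a (not necessarily normalized) element of $\ell^2(\mathbb{Z}\times\{\pm1\})$, and let $\psi_n^\epsilon$ be the $n$-th step state of the quantum walk with homogeneous coin $e^{i\epsilon\lambda\sigma_1}$ and initial state $\psi_0^\epsilon$. Then for every $t>0$, $y\in\mathbb{R}$ and $z\in\{\pm1\}$ the limit $\lim_{\epsilon\to0^+}\psi^\epsilon_{\lfloor t/\epsilon\rfloor}(\lfloor y/\epsilon\rfloor,z)$ exists and $$\psi(t,y,z):=\lim_{\epsilon\to0^+}\psi^\epsilon_{\lfloor t/\epsilon\rfloor}(\lfloor y/\epsilon\rfloor,z)=e^{\lambda t}\,\mathbb{E}\left[i^{N_t}f(Y_t,Z_t)\right],$$ where $(N_t)_{t\ge0}$ is a Poisson process of intensity $\lambda$ with $N_0=0$, $Z_t=z(-1)^{N_t}$ and $Y_t=y-z\int_0^t(-1)^{N_s}\,ds$.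
   Context: Quantum walk with homogeneous coin $C_0\in U(\ell^2(\{\pm1\}))$: on $\ell^2(\mathbb{Z}\times\{\pm1\})\cong\ell^2(\mathbb{Z})\otimes\ell^2(\{\pm1\})$ with orthonormal basis $e_xe_z$ and $\psi=\sum_{x,z}\psi(x,z)e_xe_z$, the walk operator is $W=SC$ with $C=I\otimes C_0$ and $Se_xe_z=e_{x+z}e_z$; $\psi_n=W\psi_{n-1}$ for $n\ge1$. Here $e^{i\theta\sigma_1}=\begin{bmatrix}\cos\theta&i\sin\theta\\ i\sin\theta&\cos\theta\end{bmatrix}$ in the ordered basis $(e_1,e_{-1})$. *)

(* Defs.v *)
From HB Require Import structures.
From mathcomp Require Import all_boot all_order all_algebra.
From mathcomp Require Import all_classical all_reals all_analysis.
From mathcomp Require Import complex spectral.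
From mathcomp Require Import ring lra.
Set Implicit Arguments.
Unset Strict Implicit.
Unset Printing Implicit Defensive.
Import Order.TTheory GRing.Theory Num.Theory.
Import numFieldNormedType.Exports.
Local Open Scope classical_set_scope.
Local Open Scope ring_scope.

(* [R[i]] packed as a [numClosedFieldType], so that its topology (that of the
   modulus) is found by unification. *)
Definition C (R : realType) : numClosedFieldType := R[i]%C.

(* {+1, -1} in this order: [0 : spin] is +1 and [1 : spin] is -1, so that a
   matrix ['M_2] is written in the ordered basis (e_1, e_{-1}). *)
Notation spin := 'I_2 (only parsing).

Definition sgn (z : spin) : int := (-1) ^+ z.

(* z (-1)^n; see [sgn_flip]. *)
Definition flip (n : nat) (z : spin) : spin := if odd n then rev_ord z else z.

Lemma sgn_rev (z : spin) : sgn (rev_ord z) = - sgn z.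
Proof. by case: z => [[|[|]]]. Qed.

Lemma sgn_flip n (z : spin) : sgn (flip n z) = sgn z * (-1) ^+ n.
Proof.
rewrite /flip -signr_odd; case: (odd n); last by rewrite mulr1.
by rewrite sgn_rev mulrN1.
Qed.

Section Walk.
Context {R : realType}.

Definition square_summable (psi : int * spin -> C R) : Prop :=
  summable [set: int * spin] (fun p => (Normc.normc (psi p) ^+ 2)%:E).

Record l2 := L2 {
  amplitude :> int * spin -> C R;
  _ : square_summable amplitude }.

Lemma l2P (psi : l2) : square_summable psi.
Proof. by case: psi. Qed.

Definition ket (x : int) (z : spin) : int * spin -> C R :=
  fun p => (p == (x, z))%:R.

(* The operator e_x e_z |-> e_{x+z} e_z in coordinates; see [shift_ket]. *)
Definition shift_amp (psi : int * spin -> C R) : int * spin -> C R :=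
  fun p => psi (p.1 - sgn p.2, p.2).

(* I (x) C0, in coordinates; see [coin_ket]. *)
Definition coin_amp (C0 : 'M[C R]_2) (psi : int * spin -> C R) :
    int * spin -> C R :=
  fun p => \sum_(k < 2) C0 p.2 k * psi (p.1, k).

Lemma shift_ket x z : shift_amp (ket x z) = ket (x + sgn z) z.
Proof.
apply/funext => -[a b]; rewrite /shift_amp /ket /= !xpair_eqE.
have [->|_] := eqVneq b z; last by rewrite !andbF.
by rewrite !andbT subr_eq.
Qed.

Lemma coin_ket (C0 : 'M[C R]_2) x z :
  coin_amp C0 (ket x z) = fun p => \sum_(k < 2) C0 k z * ket x k p.
Proof.
apply/funext => -[a b]; rewrite /coin_amp /ket /= (bigD1 z)//= [RHS](bigD1 b)//=.
rewrite !big1; last 2 first.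
- by move=> k kb; rewrite xpair_eqE (eq_sym b) (negPf kb) andbF mulr0.
- by move=> k kz; rewrite xpair_eqE (negPf kz) andbF mulr0.
by rewrite !xpair_eqE !eqxx.
Qed.

Lemma shift_l2 (psi : l2) : square_summable (shift_amp psi).
Proof.
have := l2P psi; rewrite /square_summable /summable.
rewrite (@reindex_esum _ _ _ [set: int * spin] [set: int * spin]
  (fun p : int * spin => (p.1 - sgn p.2, p.2)))//.
split => //.
- by move=> [a b] [c d] _ _ /= [+ bd]; rewrite bd => /addIr ->.
- by move=> [a b] _; exists (a + sgn b, b) => //=; rewrite addrK.
Qed.

Lemma normcD_sqr (a b : C R) :
  Normc.normc (a + b) ^+ 2 <= 2 * (Normc.normc a ^+ 2 + Normc.normc b ^+ 2).
Proof.
case: a => a1 a2; case: b => b1 b2 /=.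
rewrite !sqr_sqrtr ?addr_ge0 ?sqr_ge0//.
rewrite -subr_ge0 (_ : _ - _ = (a1 - b1) ^+ 2 + (a2 - b2) ^+ 2).
  by rewrite addr_ge0 ?sqr_ge0.
by ring.
Qed.

Lemma summableMn (f : int * spin -> R) n :
  summable [set: int * spin] (EFin \o f) ->
  summable [set: int * spin] (fun p => (n%:R * f p)%:E).
Proof.
move=> sf; elim: n => [|n ih].
  rewrite /summable esum1 ?ltry// => p _.
  by rewrite mul0r abse0.
have := summableD sf ih; congr (summable _ _).
by apply/funext => p /=; rewrite -EFinD -natr1 mulrDl mul1r addrC.
Qed.

Lemma rev_l2 (psi : l2) :
  summable [set: int * spin]
    (fun p => (Normc.normc (psi (p.1, rev_ord p.2)) ^+ 2)%:E).
Proof.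
have := l2P psi; rewrite /square_summable /summable.
rewrite (@reindex_esum _ _ _ [set: int * spin] [set: int * spin]
  (fun p : int * spin => (p.1, rev_ord p.2)))//.
split => //.
- by move=> [a b] [c e] _ _ /= /pair_equal_spec[-> /rev_ord_inj ->].
- by move=> [a b] _; exists (a, rev_ord b) => //=; rewrite rev_ordK.
Qed.

Lemma coin_l2 (C0 : 'M[C R]_2) (psi : l2) : square_summable (coin_amp C0 psi).
Proof.
pose s (p : int * spin) := Normc.normc (psi p) ^+ 2.
pose K := \sum_(j < 2) \sum_(k < 2) Normc.normc (C0 j k) ^+ 2.
have CK j k : Normc.normc (C0 j k) ^+ 2 <= K.
  rewrite /K (bigD1 j)//= (bigD1 k)//= -addrA lerDl addr_ge0// sumr_ge0//.
    by move=> *; rewrite sqr_ge0.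
  by move=> *; rewrite sumr_ge0// => *; rewrite sqr_ge0.
pose n := (Num.truncn (2 * K)).+1.
have Kn : 2 * K <= n%:R.
  have K0 : 0 <= K by exact: le_trans (sqr_ge0 _) (CK 0 0).
  by apply/ltW/(real_truncnS_gt _); rewrite ger0_real// mulr_ge0.
have := summableMn n (summableD (l2P psi) (rev_l2 psi)).
apply: le_lt_trans; apply: le_esum => -[x z] _ /=.
rewrite !lee_fin ger0_norm ?sqr_ge0// ger0_norm; last first.
  by rewrite mulr_ge0// addr_ge0 ?sqr_ge0.
rewrite /coin_amp (bigD1 z)//= (bigD1 (rev_ord z)); last by case: z => [[|[|]]].
rewrite /= big1 ?addr0; last first.
  by move=> k; move: z k => [[|[|]]]// ? [[|[|]]].
apply: le_trans (normcD_sqr _ _) _.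
rewrite !Normc.normcM !exprMn.
apply: le_trans (_ : 2 * K * (s (x, z) + s (x, rev_ord z)) <= _).
  rewrite -mulrA ler_pM2l// mulrDr.
  by rewrite lerD// ler_wpM2r ?sqr_ge0.
by rewrite ler_wpM2r// addr_ge0 ?sqr_ge0.
Qed.

Definition shift (psi : l2) : l2 := L2 (shift_l2 psi).

Definition coin (C0 : 'M[C R]_2) (psi : l2) : l2 := L2 (coin_l2 C0 psi).

Definition walk (C0 : 'M[C R]_2) (psi : l2) : l2 := shift (coin C0 psi).

Definition walk_state (C0 : 'M[C R]_2) (psi0 : l2) (n : nat) : l2 :=
  iter n (walk C0) psi0.

(* e^{i theta sigma_1} *)
Definition exp_sigma1 (theta : R) : 'M[C R]_2 :=
  \matrix_(j, k) (if j == k then cos theta +i* 0 else 0 +i* sin theta)%C.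

Lemma exp_sigma1_unitary theta : exp_sigma1 theta \is unitarymx.
Proof.
apply/unitarymxP/matrixP => j k.
rewrite !mxE !big_ord_recl big_ord0 !mxE /=.
have cs := cos2Dsin2 theta.
move: j k => [[|[|]]// ?] [[|[|]]// ?] /=; apply/eqP;
  rewrite eq_complex /=; apply/andP; split; apply/eqP;
  rewrite ?(mulr0, mul0r, mulrN, mulNr, addr0, add0r, subr0, opprK, oppr0);
  rewrite -?expr2 //; do ?lra.
Qed.

End Walk.

Arguments l2 : clear implicits.

Section Poisson.
Context {d : measure_display} {T : measurableType d} {R : realType}.
Variable P : probability T R.

Definition mutually_independent (n : nat) (X : 'I_n -> T -> nat) : Prop :=
  forall A : 'I_n -> set nat,
    P (\bigcap_i (X i @^-1` A i)) = (\prod_(i < n) P (X i @^-1` A i))%E.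

(* Only times t >= 0 are constrained.  Paths are nondecreasing, so the
   truncated subtraction below is the increment; right-continuity is for the
   discrete topology of nat.  All subsets of nat are measurable, hence
   [mutually_independent] is independence of nat-valued random variables. *)
Record poisson_process (lambda : R) (N : R -> {RV P >-> nat}) : Prop := {
  poisson_start : forall w, N 0 w = 0%N;
  poisson_nondecreasing : forall w s t, 0 <= s -> s <= t -> (N s w <= N t w)%N;
  poisson_right_continuous : forall w t, 0 <= t ->
    N s w @[s --> t^'+] --> N t w;
  poisson_independent : forall (n : nat) (t : nat -> R), 0 <= t 0%N ->
    nondecreasing_seq t ->
    mutually_independent (fun i : 'I_n => fun w => (N (t i.+1) w - N (t i) w)%N);
  poisson_increment : forall s t k, 0 <= s -> s < t ->
    P [set w | (N t w - N s w)%N = k] = (poisson_pmf (lambda * (t - s)) k)%:E }.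

Definition cintegrable (X : T -> C R) : Prop :=
  P.-integrable [set: T] (EFin \o (fun w => complex.Re (X w))) /\
  P.-integrable [set: T] (EFin \o (fun w => complex.Im (X w))).

Definition cexpectation (X : T -> C R) : C R :=
  (fine 'E_P[fun w => complex.Re (X w)] +i*
   fine 'E_P[fun w => complex.Im (X w)])%C.

(* y - z \int_0^t (-1)^(N_s) ds *)
Definition position (N : R -> T -> nat) (y : R) (z : spin) (t : R) (w : T) : R :=
  y - (sgn z)%:~R * \int[lebesgue_measure]_(s in `[0, t]) (-1) ^+ N s w.

End Poisson.

(* Main.v *)
Require Import Defs.
From mathcomp Require Import all_boot all_order all_algebra.
From mathcomp Require Import all_classical all_reals all_analysis.
From mathcomp Require Import measurable_realfun.
From mathcomp Require Import complex.
From mathcomp Require Import ring lra.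
Set Implicit Arguments.
Unset Strict Implicit.
Unset Printing Implicit Defensive.
Import Order.TTheory GRing.Theory Num.Theory.
Import numFieldNormedType.Exports.
Local Open Scope classical_set_scope.
Local Open Scope ring_scope.

(** The coin is itself a Poisson average. If D has the Poisson law of parameter
    theta, then E[(i sigma_1)^D] = e^(-theta) e^(i theta sigma_1): the power
    series of cosine and sine are the even and odd parts of the Poisson
    weights, signed by the powers of i (poisson_coin). So one step of the walk
    with coin e^(i eps lambda sigma_1) is, up to the factor e^(eps lambda), an
    average over the number D of jumps of N during a time eps: the spin is
    flipped D times and the amplitude is multiplied by i^D. As the increments
    of N over the cells of the grid eps Z are independent, iterating the step
    gives the exact identity (walk_state_poisson)

      psi_n(x, z) = e^(lambda n eps)
        E[i^(N_(n eps)) psi_0(x - z sum_(j < n) (-1)^(N_(j eps)),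
                              z (-1)^(N_(n eps)))],

    valid for every eps > 0, every n and every initial state.

    The limit eps -> 0 is then taken inside the expectation. Along a path of N
    the rescaled position is a left Riemann sum of the integral of (-1)^(N_s);
    a cell contributes an error only if N jumps there, so the total error is
    at most 2 eps N_t + eps (riemann_sum_error). The last grid time tends to t
    from below, and almost surely N has no jump at t (ae_poisson_no_jump), so
    the phase and the spin are eventually those at time t. Continuity of f
    gives almost sure convergence of the integrand, and f is bounded because it
    is continuous and vanishes at infinity: dominated convergence concludes. *)

(** * Convergence in the complex numbers *)

Section ComplexTopology.
Context {R : realType}.
Implicit Types (u v : C R).

Lemma normCE u : `|u| = (Normc.normc u)%:C%C.
Proof. by case: u. Qed.

Lemma normr_Re_le u : `|complex.Re u| <= Normc.normc u.
Proof.
case: u => a b /=; rewrite -sqrtr_sqr ler_sqrt ?addr_ge0 ?sqr_ge0//.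
by rewrite lerDl sqr_ge0.
Qed.

Lemma normr_Im_le u : `|complex.Im u| <= Normc.normc u.
Proof.
case: u => a b /=; rewrite -sqrtr_sqr ler_sqrt ?addr_ge0 ?sqr_ge0//.
by rewrite lerDr sqr_ge0.
Qed.

Lemma normc_le_ReIm u :
  Normc.normc u <= `|complex.Re u| + `|complex.Im u|.
Proof.
case: u => a b /=; rewrite -(ler_pXn2r (n := 2))// ?nnegrE ?sqrtr_ge0//.
  rewrite sqr_sqrtr ?addr_ge0 ?sqr_ge0// sqrrD !real_normK ?num_real//.
  rewrite addrAC lerDl.
  by rewrite mulrn_wge0// mulr_ge0.
Qed.

Lemma ReB u v : complex.Re (u - v) = complex.Re u - complex.Re v.
Proof. by case: u => ? ?; case: v. Qed.

Lemma ImB u v : complex.Im (u - v) = complex.Im u - complex.Im v.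
Proof. by case: u => ? ?; case: v. Qed.

Lemma Re_continuous : continuous (@complex.Re R : C R -> R).
Proof.
move=> u; apply/(@cvgrPdist_lt _ R _ (nbhs u)) => e e0.
have e0' : 0 < e%:C%C :> C R by rewrite ltcR.
have Fu : Filter (nbhs u) := nbhs_filter u.
have := @cvgr_dist_lt _ (C R) _ (nbhs u) Fu id u (@cvg_id _ _) _ e0'.
apply: filterS => v /=; rewrite normCE ltcR -ReB; apply: le_lt_trans.
exact: normr_Re_le.
Qed.

Lemma Im_continuous : continuous (@complex.Im R : C R -> R).
Proof.
move=> u; apply/(@cvgrPdist_lt _ R _ (nbhs u)) => e e0.
have e0' : 0 < e%:C%C :> C R by rewrite ltcR.
have Fu : Filter (nbhs u) := nbhs_filter u.
have := @cvgr_dist_lt _ (C R) _ (nbhs u) Fu id u (@cvg_id _ _) _ e0'.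
apply: filterS => v /=; rewrite normCE ltcR -ImB; apply: le_lt_trans.
exact: normr_Im_le.
Qed.

Lemma cvg_complex (S : Type) (F : set_system S) {FF : Filter F}
    (g : S -> C R) (l : C R) :
  complex.Re (g s) @[s --> F] --> complex.Re l ->
  complex.Im (g s) @[s --> F] --> complex.Im l ->
  g s @[s --> F] --> l.
Proof.
move=> /cvgrPdist_lt gRe /cvgrPdist_lt gIm; apply/cvgrPdist_lt => e.
case: e => e e' /[!ltcE]/= /andP[/eqP e'0 e0].
have e20 : 0 < e / 2 by rewrite divr_gt0.
apply: (filterS2 _ _ (gRe _ e20) (gIm _ e20)) => s.
rewrite -ReB -ImB => hR hI; rewrite normCE ltcE/= -e'0 eqxx/=.
apply: le_lt_trans (normc_le_ReIm _) _.
by rewrite (splitr e) ltrD.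
Qed.

End ComplexTopology.

(** * Expectation of complex random variables *)

Section ComplexExpectation.
Context {d : measure_display} {T : measurableType d} {R : realType}.
Variable P : probability T R.
Implicit Types X Y : T -> C R.

Lemma cexpectationE X : cexpectation P X =
  (\int[P]_w complex.Re (X w) +i* \int[P]_w complex.Im (X w))%C.
Proof. by rewrite /cexpectation unlock. Qed.

Lemma cintegrableD X Y : cintegrable P X -> cintegrable P Y ->
  cintegrable P (X \+ Y).
Proof.
move=> [Xr Xi] [Yr Yi]; split.
- have := integrableD measurableT Xr Yr; apply: eq_integrable => // w _ /=.
  by case: (X w) => ? ?; case: (Y w).
- have := integrableD measurableT Xi Yi; apply: eq_integrable => // w _ /=.
  by case: (X w) => ? ?; case: (Y w).
Qed.

Lemma cexpectationD X Y : cintegrable P X -> cintegrable P Y ->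
  cexpectation P (X \+ Y) = cexpectation P X + cexpectation P Y.
Proof.
move=> [Xr Xi] [Yr Yi]; rewrite !cexpectationE /=; congr (_ +i* _)%C.
- rewrite -RintegralD//; apply: eq_Rintegral => w _ /=.
  by case: (X w) => ? ?; case: (Y w).
- rewrite -RintegralD//; apply: eq_Rintegral => w _ /=.
  by case: (X w) => ? ?; case: (Y w).
Qed.

Lemma integrable_lin (a b : R) (g h : T -> R) :
  P.-integrable setT (EFin \o g) -> P.-integrable setT (EFin \o h) ->
  P.-integrable setT (EFin \o (fun w => a * g w + b * h w)).
Proof.
move=> ig ih.
have := integrableD measurableT (integrableZl measurableT a ig)
  (integrableZl measurableT b ih).
by apply: eq_integrable.
Qed.

Lemma Rintegral_lin (a b : R) (g h : T -> R) :
  P.-integrable setT (EFin \o g) -> P.-integrable setT (EFin \o h) ->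
  \int[P]_w (a * g w + b * h w) = a * \int[P]_w g w + b * \int[P]_w h w.
Proof.
move=> ig ih; rewrite RintegralD//; last 2 first.
- by have := integrableZl measurableT a ig; apply: eq_integrable.
- by have := integrableZl measurableT b ih; apply: eq_integrable.
by rewrite !RintegralZl.
Qed.

Lemma cintegrableZ (c : C R) X : cintegrable P X ->
  cintegrable P (fun w => c * X w).
Proof.
case: c => a b [Xr Xi]; split.
- have := integrable_lin a (- b) Xr Xi; apply: eq_integrable => // w _ /=.
  by case: (X w) => ? ? /=; rewrite mulNr.
- have := integrable_lin a b Xi Xr; apply: eq_integrable => // w _ /=.
  by case: (X w) => ? ? /=.
Qed.

Lemma cexpectationZ (c : C R) X : cintegrable P X ->
  cexpectation P (fun w => c * X w) = c * cexpectation P X.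
Proof.
case: c => a b [Xr Xi]; rewrite !cexpectationE /=.
rewrite [RHS]/GRing.mul/=; congr (_ +i* _)%C.
- rewrite -mulNr -Rintegral_lin//; apply: eq_Rintegral => w _ /=.
  by case: (X w) => ? ? /=; rewrite mulNr.
- rewrite -Rintegral_lin//; apply: eq_Rintegral => w _ /=.
  by case: (X w) => ? ? /=.
Qed.

Lemma cintegrable_sum (I : Type) (s : seq I) (X : I -> T -> C R) :
  (forall i, cintegrable P (X i)) ->
  cintegrable P (fun w => \sum_(i <- s) X i w).
Proof.
move=> iX; elim: s => [|i s ih].
  under eq_fun do rewrite big_nil.
  by split => /=; exact: integrable0.
under eq_fun do rewrite big_cons.
exact: cintegrableD.
Qed.

Lemma cexpectation_sum (I : Type) (s : seq I) (X : I -> T -> C R) :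
  (forall i, cintegrable P (X i)) ->
  cexpectation P (fun w => \sum_(i <- s) X i w) =
  \sum_(i <- s) cexpectation P (X i).
Proof.
move=> iX; elim: s => [|i s ih].
  under eq_fun do rewrite big_nil.
  by rewrite big_nil cexpectationE /Rintegral/= integral0.
under eq_fun do rewrite big_cons.
by rewrite big_cons -ih; apply: cexpectationD => //; exact: cintegrable_sum.
Qed.

Lemma cintegrable_indic (B : set T) : measurable B ->
  cintegrable P (fun w => (\1_B w)%:C%C).
Proof.
move=> mB; split; last by apply: integrable0.
exact: (integrable_indic P mB).
Qed.

Lemma cexpectation_indic (B : set T) : measurable B ->
  cexpectation P (fun w => (\1_B w)%:C%C) = (fine (P B))%:C%C.
Proof.
move=> mB; rewrite cexpectationE /= {2}/Rintegral integral0/=.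
congr (_ +i* _)%C.
by rewrite /Rintegral integral_indic// setIT.
Qed.

(** One-sided limits reduce to sequences, where real dominated convergence
    applies to the real and imaginary parts. *)
Lemma cexpectation_dominated (X_ : R -> T -> C R) X (M p : R) :
  (forall e, p < e -> cintegrable P (X_ e)) -> cintegrable P X ->
  (forall e w, p < e -> Normc.normc (X_ e w) <= M) ->
  {ae P, forall w, X_ e w @[e --> p^'+] --> X w} ->
  cexpectation P (X_ e) @[e --> p^'+] --> cexpectation P X.
Proof.
move=> iX_ iX XM XX; rewrite cexpectationE.
under eq_fun do rewrite cexpectationE.
have iM : P.-integrable setT (cst M%:E) by exact: finite_measure_integrable_cst.
have part (g : C R -> R) : continuous g ->
    (forall u, `|g u| <= Normc.normc u) ->
    (forall e, p < e -> P.-integrable setT (EFin \o (g \o X_ e))) ->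
    P.-integrable setT (EFin \o (g \o X)) ->
    \int[P]_w g (X_ e w) @[e --> p^'+] --> \int[P]_w g (X w).
  move=> cg gle igX_ igX; apply/cvg_at_rightP => u [pu up].
  have [] := @dominated_convergence _ _ _ P _ measurableT
    (fun n => EFin \o (g \o X_ (u n))) (EFin \o (g \o X)) (cst M%:E).
  - by move=> n; exact: measurable_int (igX_ _ (pu n)).
  - exact: measurable_int igX.
  - apply: filterS XX => w Xw _ /=; apply: cvg_EFin; first exact: nearW.
    have gXw : (g \o X_ ^~ w) e @[e --> p^'+] --> g (X w).
      exact: (cvg_comp _ _ Xw (cg _)).
    exact: ((cvg_at_rightP _ _ _).1 gXw u (conj pu up)).
  - exact: iM.
  - by apply: aeW => w n _ /=; rewrite lee_fin (le_trans (gle _))// XM.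
  move=> _ _ h; apply: fine_cvg.
  by rewrite fineK//; apply: integrable_fin_num.
apply: cvg_complex => /=.
- apply: (part (@complex.Re R)) iX.1;
    [exact: Re_continuous|exact: normr_Re_le|].
  by move=> e pe; exact: (iX_ e pe).1.
- apply: (part (@complex.Im R)) iX.2;
    [exact: Im_continuous|exact: normr_Im_le|].
  by move=> e pe; exact: (iX_ e pe).2.
Qed.

End ComplexExpectation.

(** * The coin as a Poisson average *)

(** The real part of i^k, which has period 4 in k, against the coefficients of
    the cosine series. *)
Lemma sub_residue_even (R : realType) (k : nat) :
  (k %% 4 == 0)%N%:R - (k %% 4 == 2)%N%:R = (~~ odd k)%:R * (-1) ^+ k./2 :> R.
Proof.
elim/ltn_ind: k => -[|[|[|[|k]]]] ih;
  rewrite ?expr0 ?expr1 ?mul0r ?mul1r ?subr0 ?sub0r//.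
have -> : (k.+4 %% 4 = k %% 4)%N by rewrite -addn4 modnDr.
rewrite ih /=; last exact: (leq_addl 3 k).
by rewrite ?negbK !exprS !mulN1r opprK.
Qed.

(** The imaginary part of i^k, against the coefficients of the sine series. *)
Lemma sub_residue_odd (R : realType) (k : nat) :
  (k %% 4 == 1)%N%:R - (k %% 4 == 3)%N%:R = (odd k)%:R * (-1) ^+ k.-1./2 :> R.
Proof.
elim/ltn_ind: k => -[|[|[|[|[|k]]]]] ih;
  rewrite ?expr0 ?expr1 ?mul0r ?mul1r ?subr0 ?sub0r//.
have -> : (k.+4.+1 %% 4 = k.+1 %% 4)%N by rewrite -(modnDr k.+1 4) addn4.
rewrite ih /=; last exact: (leq_addl 3 k).
by rewrite ?negbK !exprS !mulN1r opprK.
Qed.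

Section PoissonCoin.
Context {d : measure_display} {T : measurableType d} {R : realType}.
Variable P : probability T R.
Variables (K : T -> nat) (theta : R).
Hypothesis mK : forall A : set nat, measurable (K @^-1` A).
Hypothesis theta0 : 0 < theta.
Hypothesis K_poisson : forall k, P (K @^-1` [set k]) = (poisson_pmf theta k)%:E.

(** Countable additivity over the level sets of K. Partial sums are used, rather
    than an infinite sum in the extended reals, because cosine and sine are
    limits of real partial sums and differences of such limits are needed. *)
Lemma cvg_series_pmf (A : set nat) :
  series (fun k => (k \in A)%:R * poisson_pmf theta k) n @[n --> \oo] -->
  fine (P (K @^-1` A)).
Proof.
have KA : K @^-1` A = \bigcup_k (K @^-1` ([set k] `&` A)).
  apply/seteqP; split => [w Aw|w [k _ [/= -> //]]].
  by exists (K w).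
suff : (series (fun k => (k \in A)%:R * poisson_pmf theta k) n)%:E
    @[n --> \oo] --> (fine (P (K @^-1` A)))%:E by exact: fine_cvg.
rewrite fineK ?fin_num_measure//.
have : (fun n => \sum_(0 <= k < n) P (K @^-1` ([set k] `&` A)))%E @ \oo -->
    P (K @^-1` A).
  rewrite [X in _ --> P X]KA; apply: measure_semi_sigma_additive => //.
    apply/trivIsetP => i j _ _ ij; rewrite -preimage_setI; apply/seteqP.
    by split => // w [[-> _] [/eqP]]; rewrite (negPf ij).
  by rewrite -KA.
apply: cvg_trans; apply: near_eq_cvg; apply: nearW => n.
rewrite /series/= -sumEFin; apply: eq_bigr => k _.
have [kA|kA] := boolP (k \in A).
  by rewrite mul1r -K_poisson setIidl// => _ ->; exact: set_mem.
rewrite mul0r (_ : _ `&` _ = set0) ?preimage_set0 ?measure0//.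
by apply/seteqP; split => // _ [-> /mem_set]; rewrite (negPf kA).
Qed.

Let residue (a : nat) := fine (P (K @^-1` [set k | (k %% 4)%N = a])).

Let in_residue k a : (k \in [set k | (k %% 4)%N = a]) = ((k %% 4)%N == a).
Proof. by apply/idP/eqP => [/set_mem|/mem_set]. Qed.

Let u (a : nat) :=
  series (fun k => (k \in [set k | (k %% 4)%N = a])%:R * poisson_pmf theta k).

Lemma residue_cos : residue 0 - residue 2 = expR (- theta) * cos theta.
Proof.
have h : u 0%N n - u 2%N n @[n --> \oo] --> residue 0 - residue 2.
  by apply: cvgB; exact: cvg_series_pmf.
rewrite -(cvg_lim (@Rhausdorff R) h); apply: cvg_lim => //.
have -> : cos theta = lim (series (cos_coeff theta) @ \oo) by rewrite unlock.
have : expR (- theta) * series (cos_coeff theta) n @[n --> \oo] -->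
    expR (- theta) * lim (series (cos_coeff theta) @ \oo).
  by apply: cvgM; [exact: cvg_cst|exact: is_cvg_series_cos_coeff].
apply: cvg_trans; apply: near_eq_cvg; apply: nearW => n.
rewrite /u /series/= big_distrr -sumrB /=; apply: eq_bigr => k _.
rewrite !in_residue -mulrBl sub_residue_even /poisson_pmf theta0.
rewrite /cos_coeff /= -exprnP.
by ring.
Qed.

Lemma residue_sin : residue 1 - residue 3 = expR (- theta) * sin theta.
Proof.
have h : u 1%N n - u 3%N n @[n --> \oo] --> residue 1 - residue 3.
  by apply: cvgB; exact: cvg_series_pmf.
rewrite -(cvg_lim (@Rhausdorff R) h); apply: cvg_lim => //.
have -> : sin theta = lim (series (sin_coeff theta) @ \oo) by rewrite unlock.
have : expR (- theta) * series (sin_coeff theta) n @[n --> \oo] -->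
    expR (- theta) * lim (series (sin_coeff theta) @ \oo).
  by apply: cvgM; [exact: cvg_cst|exact: is_cvg_series_sin_coeff].
apply: cvg_trans; apply: near_eq_cvg; apply: nearW => n.
rewrite /u /series/= big_distrr -sumrB /=; apply: eq_bigr => k _.
rewrite !in_residue -mulrBl sub_residue_odd /poisson_pmf theta0 /sin_coeff /=.
by ring.
Qed.

(** This is e^(-theta) e^(i theta sigma_1) = E[(i sigma_1)^K]. Both i^k and the
    k-fold flip depend on k modulo 4 only, so the expectation is a sum of four
    terms. *)
Lemma poisson_coin (g : spin -> C R) (z : spin) :
  \sum_(a < 4) (residue a)%:C%C * ('i%C ^+ a * g (flip a z)) =
  (expR (- theta))%:C%C * \sum_(k < 2) exp_sigma1 theta z k * g k :> C R.
Proof.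
rewrite !big_ord_recl !big_ord0 /=.
have /eqP := residue_cos; rewrite subr_eq => /eqP -> .
have /eqP := residue_sin; rewrite subr_eq => /eqP -> .
have rev0 : rev_ord ord0 = lift ord0 ord0 :> spin by apply/val_inj.
have rev1 : rev_ord (lift ord0 ord0) = ord0 :> spin by apply/val_inj.
have [->|->] : z = ord0 \/ z = lift ord0 ord0.
  by case: z => [[|[|]]// ?]; [left|right]; apply/val_inj.
all: rewrite !mxE /flip /= ?rev0 ?rev1.
all: case: (g ord0) (g (lift ord0 ord0)) => a b [c e].
all: rewrite ?eqxx /=.
- apply/eqP; rewrite eq_complex /=; apply/andP; split; apply/eqP; ring.
- apply/eqP; rewrite eq_complex /=; apply/andP; split; apply/eqP; ring.
Qed.

End PoissonCoin.

(** * The walk as an expectation over jump counts *)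

(** The contribution of one history to the walk: a j is the number of flips
    made at the j-th step backwards in time from (x, z), each flip carrying a
    factor i. Peeling the first entry matches the recursion of the walk, whose
    last step is the outermost one. *)
Fixpoint path_amplitude (R : realType) (psi : int * spin -> C R) (n : nat)
    (a : nat -> nat) (x : int) (z : spin) : C R :=
  if n is n'.+1 then
    'i%C ^+ a 0%N *
    path_amplitude psi n' (fun j => a j.+1) (x - sgn z) (flip (a 0%N) z)
  else psi (x, z).

Lemma iX_mod4 (R : realType) k : 'i%C ^+ (k %% 4) = 'i%C ^+ k :> C R.
Proof.
apply: expr_mod; rewrite -[4%N]/(2 * 2)%N exprM.
by rewrite [X in X ^+ 2]sqr_i sqrrN expr1n.
Qed.

Lemma flip_mod4 k (z : spin) : flip (k %% 4) z = flip k z.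
Proof. by rewrite /flip odd_mod. Qed.

Lemma walk_stateS (R : realType) (C0 : 'M[C R]_2) (psi : l2 R) n x z :
  walk_state C0 psi n.+1 (x, z) =
  \sum_(k < 2) C0 z k * walk_state C0 psi n (x - sgn z, k).
Proof. by []. Qed.

Section FeynmanKac.
Context {d : measure_display} {T : measurableType d} {R : realType}.
Variable P : probability T R.
Variables (D : nat -> T -> nat) (theta : R).
Hypothesis mD : forall j (A : set nat), measurable (D j @^-1` A).
Hypothesis theta0 : 0 < theta.
Hypothesis D_indep : forall n (A : nat -> set nat),
  P (\bigcap_(i : 'I_n) (D i @^-1` A i)) = (\prod_(i < n) P (D i @^-1` A i))%E.
Hypothesis D_poisson : forall j k,
  P (D j @^-1` [set k]) = (poisson_pmf theta k)%:E.

Let past m (A : nat -> set nat) := \bigcap_(i : 'I_m) (D i @^-1` A i).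

Let measurable_past m A : measurable (past m A).
Proof. by apply: fin_bigcap_measurable => // i _. Qed.

Let fine_past m A :
  fine (P (past m A)) = \prod_(i < m) fine (P (D i @^-1` A i)).
Proof.
rewrite /past D_indep; elim: m => [|m ih]; first by rewrite !big_ord0.
rewrite !big_ord_recr /= fineM ?ih ?fin_num_measure//.
by rewrite -D_indep fin_num_measure//; exact: measurable_past.
Qed.

Let cons_past (m : nat) (A : nat -> set nat) (a j : nat) : set nat :=
  if j == m then [set k | (k %% 4)%N = a] else A j.

Let past_cons m A a w :
  (w \in past m.+1 (cons_past m A a)) = (w \in past m A) && (D m w %% 4 == a)%N.
Proof.
apply/idP/andP => [/set_mem h|[/set_mem h /eqP Da]].
- split; last first.
    by have := h ord_max I; rewrite /cons_past /= eqxx => /eqP.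
  apply/mem_set => i _; have := h (widen_ord (leqnSn m) i) I.
  by rewrite /cons_past /= ltn_eqF.
- apply/mem_set => -[i im] _; rewrite /cons_past /=; case: eqVneq => [->//|ni].
  have {}im : (i < m)%N by rewrite ltn_neqAle ni -ltnS.
  exact: (h (Ordinal im) I).
Qed.

Let X (psi : l2 R) n m A x z w : C R :=
  (\1_(past m A) w)%:C%C * path_amplitude psi n (fun j => D (m + j)%N w) x z.

Let XS psi n m A x z : X psi n.+1 m A x z = fun w => \sum_(a < 4)
  ('i%C ^+ a * X psi n m.+1 (cons_past m A a) (x - sgn z) (flip a z) w).
Proof.
apply/funext => w; rewrite /X.
have D4 : (D m w %% 4 < 4)%N by rewrite ltn_mod.
rewrite (bigD1 (Ordinal D4))//= big1 ?addr0.
  rewrite !indicE past_cons /= eqxx andbT addn0 iX_mod4 flip_mod4 mulrCA.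
  by under [in RHS]eq_fun do rewrite addSnnS.
move=> a aD; rewrite !indicE past_cons /=.
suff -> : (D m w %% 4 == a)%N = false by rewrite andbF mul0r mulr0.
by apply/negbTE; apply: contraNneq aD => Da; apply/eqP/val_inj.
Qed.

(* The induction removes the first step, whose flips are those of D m. The
   remaining steps are independent of it, but conditioning is avoided by
   carrying the event that D_0, .., D_(m-1) lie in prescribed sets: the residue
   of D m modulo 4 is one more such constraint. *)
Let expectation_X psi n m A x z :
  cintegrable P (X psi n m A x z) /\
  cexpectation P (X psi n m A x z) =
    (fine (P (past m A)) * expR (- theta) ^+ n)%:C%C *
    walk_state (exp_sigma1 theta) psi n (x, z).
Proof.
elim: n m A x z => [|n ih] m A x z.
  have XE : X psi 0 m A x z = fun w => psi (x, z) * (\1_(past m A) w)%:C%C.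
    by apply/funext => w; rewrite /X mulrC.
  have mA := cintegrable_indic P (measurable_past m A).
  split; first by rewrite XE; exact: cintegrableZ.
  by rewrite XE cexpectationZ// cexpectation_indic// expr0 mulr1 mulrC.
have iX a : cintegrable P (fun w =>
    'i%C ^+ a * X psi n m.+1 (cons_past m A a) (x - sgn z) (flip a z) w).
  by apply: cintegrableZ; exact: (ih _ _ _ _).1.
rewrite XS; split; first exact: cintegrable_sum.
rewrite cexpectation_sum// walk_stateS.
under eq_bigr => a _.
  rewrite cexpectationZ; last exact: (ih _ _ _ _).1.
  rewrite (ih _ _ _ _).2 fine_past big_ord_recr /= {2}/cons_past eqxx.
  rewrite (eq_bigr (fun i : 'I_m => fine (P (D i @^-1` A i)))); last first.
    by move=> i _; rewrite /cons_past ltn_eqF.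
  rewrite -fine_past.
  rewrite [_ * expR _ ^+ n]mulrAC [(_ * fine _)%:C%C]rmorphM /= mulrCA -!mulrA.
  rewrite [_ * ('i%C ^+ a * _)]mulrC.
  over.
rewrite -mulr_sumr exprSr mulrA.
rewrite [in RHS]rmorphM -[RHS]mulrA /=; congr (_ * _).
rewrite -(poisson_coin (mD m) theta0 (D_poisson m)
  (fun k => walk_state (exp_sigma1 theta) psi n (x - sgn z, k))).
by apply: eq_bigr => a _; rewrite mulrC.
Qed.

(** The exact identity for independent Poisson flip counts, the case in which no
    constraint is put on the past. *)
Lemma walk_state_expectation (psi : l2 R) n x z :
  cintegrable P (fun w => path_amplitude psi n (D ^~ w) x z) /\
  cexpectation P (fun w => path_amplitude psi n (D ^~ w) x z) =
    (expR (- theta) ^+ n)%:C%C * walk_state (exp_sigma1 theta) psi n (x, z).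
Proof.
have := expectation_X psi n 0 (fun=> setT) x z.
have past0 : past 0 (fun=> setT) = setT by apply/seteqP; split => // w _ [].
rewrite past0 probability_setT mul1r /X past0.
by under eq_fun do rewrite indicT mul1r.
Qed.

End FeynmanKac.

Lemma flipD m n (z : spin) : flip m (flip n z) = flip (n + m) z.
Proof.
by rewrite /flip oddD; case: (odd m); case: (odd n); rewrite //= rev_ordK.
Qed.

(** When the flip counts are the increments of a counting path c, the flips made
    up to the j-th step telescope to c j - c 0. *)
Lemma path_amplitudeE (R : realType) (psi : int * spin -> C R) n
    (c : nat -> nat) x z :
  (forall j, c j <= c j.+1)%N ->
  path_amplitude psi n (fun j => c j.+1 - c j)%N x z =
  'i%C ^+ (c n - c 0%N) *
  psi (x - sgn z * \sum_(j < n) (-1) ^+ (c j - c 0%N), flip (c n - c 0%N) z).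
Proof.
elim: n c x z => [|n ih] c x z c_nd.
  by rewrite subnn /= big_ord0 mulr0 subr0 expr0 mul1r.
have c_le : forall i j, (i <= j)%N -> (c i <= c j)%N.
  apply: (homo_leq (r := fun a b => (a <= b)%N)) => //.
  by move=> ? ? ?; exact: leq_trans.
have cD i : (c 1%N - c 0%N + (c i.+1 - c 1%N) = c i.+1 - c 0%N)%N.
  by rewrite addnC addnBA ?c_le// subnK ?c_le.
rewrite /= (ih (fun j => c j.+1))//= mulrA -exprD flipD cD.
congr (_ * psi (_, _)).
rewrite big_ord_recl subnn expr0 mulrDr mulr1 opprD addrA.
rewrite sgn_flip -mulrA; congr (_ - _ * _).
by rewrite mulr_sumr; apply: eq_bigr => j _; rewrite -exprD cD.
Qed.

(** * Riemann sums along a counting path *)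

Section PathIntegral.
Context {R : realType}.
Variable c : R -> nat.
Hypothesis c_nd : forall s t, 0 <= s -> s <= t -> (c s <= c t)%N.
Notation mu := (@lebesgue_measure R).

Let h (s : R) : R := (-1) ^+ c s.

(* The level sets of a monotone c are intervals, hence c is measurable. *)
Let integrable_h (i : interval R) : [set` i] `<=` [set s | 0 <= s] ->
  (mu [set` i] < +oo)%E -> mu.-integrable [set` i] (EFin \o h).
Proof.
move=> i0 ifin; apply: measurable_bounded_integrable => //.
- have mc : measurable_fun [set` i] c.
    move=> _ A _.
    rewrite (_ : _ `&` _ = \bigcup_k ([set` i] `&` c @^-1` ([set k] `&` A))).
      apply: bigcup_measurable => k _.
      have [kA|kA] := pselect (A k).
        rewrite (setIidl (_ : [set k] `<=` A)); last by move=> _ ->.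
        apply: is_interval_measurable => s t [si cs] [ti ct] u /andP[su ut].
        have ui : u \in i by apply: (interval_is_interval si ti); exact/andP.
        split => //=; apply/eqP; rewrite eqn_leq -{1}ct -cs.
        by rewrite !c_nd ?i0.
      rewrite (_ : [set k] `&` A = set0) ?preimage_set0 ?setI0//.
      by apply/seteqP; split => // _ [->].
    apply/seteqP; split => [s [si cA]|s [k _ [si [ck cA]]]]; last by [].
    by exists (c s).
  have ms : measurable_fun setT (fun k : nat => (-1) ^+ k : R) by move=> _ B _.
  exact: (measurableT_comp ms mc).
- exists 1; split => // M M1 s _ /=.
  by rewrite normrX normrN1 expr1n ltW.
Qed.

Let normr_h s : `|h s| = 1.
Proof. by rewrite normrX normrN1 expr1n. Qed.

Let integrable_itv a b x y : 0 <= x ->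
  mu.-integrable [set` Interval (BSide a x) (BSide b y)] (EFin \o h).
Proof.
move=> x0; apply: integrable_h.
  move=> s /=; rewrite itv_boundlr => /andP[+ _].
  by case: a => /=; rewrite bnd_simp => xs; rewrite (le_trans x0)// ltW.
rewrite lebesgue_measure_itv; case: ifP => _; last by rewrite ltry.
by rewrite -EFinB ltry.
Qed.

Let fine_itvoc x y : x <= y -> fine (mu `]x, y]%classic) = y - x.
Proof.
move=> xy; rewrite lebesgue_measure_itv /= lte_fin.
by case: ltgtP xy => // -> _; rewrite subrr.
Qed.

Let normr_int_le x y : 0 <= x -> x <= y ->
  `|\int[mu]_(s in `]x, y]) h s| <= y - x.
Proof.
move=> x0 xy.
apply: le_trans (le_normr_Rintegral _ (integrable_itv _ _ _ x0)) _ => //.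
under eq_Rintegral do rewrite normr_h.
by rewrite Rintegral_cst// mul1r fine_itvoc.
Qed.

Let int_split x y : 0 <= x -> x <= y ->
  \int[mu]_(s in `[0, y]) h s =
  \int[mu]_(s in `[0, x]) h s + \int[mu]_(s in `]x, y]) h s.
Proof.
move=> x0 xy; rewrite -(@Rintegral_itvB _ h (BLeft 0) (BRight y) x)//.
- by rewrite addrC subrK.
- exact: integrable_itv.
Qed.

(** On a cell without jump the Riemann sum is exact; on any other cell the error
    is at most 2 eps, and there are at most c (n eps) such cells. *)
Lemma riemann_sum_error eps t n : 0 <= eps -> n%:R * eps <= t ->
  `|eps * (\sum_(j < n) h (j%:R * eps)) - \int[mu]_(s in `[0, t]) h s| <=
  2 * eps * (c (n%:R * eps))%:R + (t - n%:R * eps).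
Proof.
move=> eps0 net.
have ne0 m : 0 <= m%:R * eps by rewrite mulr_ge0.
rewrite (int_split (ne0 n) net) opprD addrA.
apply: le_trans (ler_normB _ _) _; rewrite lerD ?normr_int_le//.
elim: n {t net} => [|n ih].
  rewrite big_ord0 mulr0 mul0r sub0r normrN set_itv1 Rintegral_set1 normr0.
  by rewrite !mulr_ge0.
have nS : n%:R * eps <= n.+1%:R * eps by rewrite ler_wpM2r// ler_nat.
rewrite (int_split (ne0 n) nS) big_ord_recr /= mulrDr opprD addrACA.
apply: le_trans (ler_normD _ _) _.
rewrite -[(c (n.+1%:R * eps))%:R](subrK (c (n%:R * eps))%:R) mulrDr.
rewrite [leRHS]addrC lerD//.
have lenS : n.+1%:R * eps - n%:R * eps = eps.
  by rewrite -mulrBl -natrB// subSnn mul1r.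
have cle := c_nd (ne0 n) nS.
have [cn|cn] := eqVneq (c (n%:R * eps)) (c (n.+1%:R * eps)).
  rewrite cn subrr mulr0 (_ : \int[mu]_(s in _) _ = eps * h (n%:R * eps)).
    by rewrite subrr normr0.
  transitivity (\int[mu]_(s in `]n%:R * eps, n.+1%:R * eps]) h (n%:R * eps)).
    apply: eq_Rintegral => s /set_mem /=.
    rewrite in_itv /= => /andP[/ltW ns sn].
    rewrite /h; congr (_ ^+ _); apply/eqP; rewrite eqn_leq.
    by rewrite (c_nd (ne0 n) ns) {1}cn (c_nd (le_trans (ne0 n) ns) sn).
  by rewrite Rintegral_cst// fine_itvoc// lenS mulrC.
apply: (@le_trans _ _ (2 * eps)).
  apply: le_trans (ler_normB _ _) _.
  rewrite normrM normr_h mulr1 ger0_norm// (mulrDl 1 1) mul1r lerD//.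
  by rewrite (le_trans (normr_int_le _ _))// lenS.
rewrite ler_peMr ?mulr_ge0// -natrB// ler1n subn_gt0 ltn_neqAle cn.
exact: cle.
Qed.

End PathIntegral.

(** * Boundedness and measurability of the integrand *)

Section BoundedAmplitude.
Context {R : realType}.

Lemma bounded_vanishing (g : R -> R) : continuous g ->
  g y @[y --> +oo%R] --> (0 : R) -> g y @[y --> -oo%R] --> (0 : R) ->
  exists M, forall y, `|g y| <= M.
Proof.
move=> cg gp gm.
have [a [_ ga]] : \forall y \near +oo%R, `|0 - g y| < 1.
  by have /cvgrPdist_lt := gp; apply.
have [b [_ gb]] : \forall y \near -oo%R, `|0 - g y| < 1.
  by have /cvgrPdist_lt := gm; apply.
have cgw : {within `[b, a], continuous g} by exact: continuous_subspaceT.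
have /compact_bounded[K [_ gK]] :=
  continuous_compact cgw (@segment_compact R b a).
(* Outside [b, a] the bound is 1; inside, every number above K is a bound. *)
exists (Num.max 1 (K + 1)) => y; rewrite le_max.
have [ay|ya] := ltP a y; first by rewrite -normrN -sub0r ltW ?ga.
have [yb|yb] := ltP y b; first by rewrite -normrN -sub0r ltW ?gb.
apply/orP; right; apply: (gK (K + 1)); first by rewrite ltrDl.
by exists y => //=; rewrite in_itv/= yb.
Qed.

Lemma normc_vanishing_bounded (f : R -> C R) : continuous f ->
  `|f y| @[y --> +oo%R] --> (0 : C R) -> `|f y| @[y --> -oo%R] --> (0 : C R) ->
  exists M, forall y, Normc.normc (f y) <= M.
Proof.
move=> cf fp fm.
have [||| M gM] := @bounded_vanishing (fun y => complex.Re `|f y|).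
- move=> y; apply: (@cvg_comp _ _ _ (fun y => `|f y| : C R)); last first.
    exact: Re_continuous.
  apply: (@cvg_comp _ _ _ f); first exact: cf.
  exact: (@norm_continuous _ (C R)).
- exact: (cvg_comp _ _ fp (@Re_continuous R _)).
- exact: (cvg_comp _ _ fm (@Re_continuous R _)).
exists M => y; apply: le_trans (gM y); rewrite normCE /=.
exact: ler_norm.
Qed.

Lemma normc_iX k : Normc.normc ('i%C ^+ k : C R) = 1.
Proof.
elim: k => [|k ih]; first by rewrite expr0 Normc.normc1.
by rewrite exprS Normc.normcM ih /= expr0n expr1n add0r sqrtr1 mulr1.
Qed.

End BoundedAmplitude.

Section RandomPhase.
Context {d : measure_display} {T : measurableType d} {R : realType}.
Variable P : probability T R.

Lemma measurable_fun_nat_param (d' : measure_display) (U : measurableType d')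
    (g : nat -> T -> U) (K : T -> nat) :
  (forall k, measurable_fun setT (g k)) -> measurable_fun setT K ->
  measurable_fun setT (fun w => g (K w) w).
Proof.
move=> mg mK _ B mB; rewrite setTI.
rewrite (_ : _ @^-1` _ = \bigcup_k (K @^-1` [set k] `&` g k @^-1` B)).
  apply: bigcup_measurable => k _; apply: measurableI.
    by rewrite -[X in measurable X]setTI; exact: mK.
  by rewrite -[X in measurable X]setTI; exact: mg.
by apply/seteqP; split => [w gB|w [k _ [<-]]]; first exists (K w).
Qed.

(** Measurability is checked for each value k of K separately; for fixed k the
    variable is a continuous function of Y. *)
Lemma cintegrable_phase (f : R -> spin -> C R) (M : R) (K : T -> nat)
    (Y : T -> R) (z : spin) :
  (forall z, continuous (f ^~ z)) -> (forall y z, Normc.normc (f y z) <= M) ->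
  measurable_fun setT K -> measurable_fun setT Y ->
  cintegrable P (fun w => 'i%C ^+ K w * f (Y w) (flip (K w) z)).
Proof.
move=> cf fM mK mY.
have XM w : Normc.normc ('i%C ^+ K w * f (Y w) (flip (K w) z) : C R) <= M.
  by rewrite Normc.normcM normc_iX mul1r.
have part (g : C R -> R) : continuous g ->
    (forall u, `|g u| <= Normc.normc u) ->
    P.-integrable setT
      (EFin \o (fun w => g ('i%C ^+ K w * f (Y w) (flip (K w) z)))).
  move=> cg gle; apply: measurable_bounded_integrable => //.
  - by rewrite (le_lt_trans (probability_le1 _ _))// ltry.
  - apply: (@measurable_fun_nat_param _ _
      (fun k w => g ('i%C ^+ k * f (Y w) (flip k z)))) => // k.
    pose G (y : R) := g ('i%C ^+ k * f y (flip k z)).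
    suff cG : continuous G.
      exact: (measurableT_comp (continuous_measurable_fun cG) mY).
    move=> y; apply: (@cvg_comp _ _ _ (fun y => 'i%C ^+ k * f y (flip k z)));
      last exact: cg.
    have := @mulrl_continuous (C R) ('i%C ^+ k) (f y (flip k z)).
    exact: (cvg_comp _ _ (cf (flip k z) y)).
  - exists M; split; first exact: num_real.
    by move=> x Mx w _ /=; rewrite (le_trans (gle _))// (le_trans (XM w))// ltW.
split.
- apply: (part (@complex.Re R)); [exact: Re_continuous|exact: normr_Re_le].
- apply: (part (@complex.Im R)); [exact: Im_continuous|exact: normr_Im_le].
Qed.

End RandomPhase.

(** * The walk and the Poisson process *)

Section PoissonWalk.
Context {d : measure_display} {T : measurableType d} {R : realType}.
Variable P : probability T R.
Variables (lambda : R) (N : R -> {RV P >-> nat}).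
Hypothesis lambda0 : 0 < lambda.
Hypothesis NP : poisson_process lambda N.

Let measurable_N s : measurable_fun setT (N s).
Proof. exact: measurable_funP. Qed.

Lemma measurable_increment s t (A : set nat) :
  measurable ((fun w => N t w - N s w)%N @^-1` A).
Proof.
rewrite -[X in measurable X]setTI.
apply: (measurable_fun_nat_param (g := fun k w => (N t w - k)%N)) => // k.
have mk : measurable_fun setT (fun m => (m - k)%N) by move=> _ B _.
exact: (measurableT_comp mk (measurable_N t)).
Qed.

(** Observing N on the grid eps Z realizes the independent flip counts by its
    increments, which are Poisson of parameter eps lambda. *)
Lemma walk_state_poisson (psi : l2 R) (eps : R) n x z : 0 < eps ->
  walk_state (exp_sigma1 (eps * lambda)) psi n (x, z) =
  (expR (lambda * (n%:R * eps)))%:C%C *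
  cexpectation P (fun w => 'i%C ^+ N (n%:R * eps) w *
    psi (x - sgn z * \sum_(j < n) (-1) ^+ N (j%:R * eps) w,
         flip (N (n%:R * eps) w) z)).
Proof.
move=> eps0.
pose grid (j : nat) : R := j%:R * eps.
have grid_ge0 j : 0 <= grid j by rewrite mulr_ge0// ltW.
have gridS j : grid j.+1 - grid j = eps.
  by rewrite /grid -mulrBl -natrB// subSnn mul1r.
have grid_lt j : grid j < grid j.+1 by rewrite -subr_gt0 gridS.
pose D (j : nat) w := (N (grid j.+1) w - N (grid j) w)%N.
have D_indep n' (A : nat -> set nat) :
    P (\bigcap_(i : 'I_n') (D i @^-1` A i)) =
    (\prod_(i < n') P (D i @^-1` A i))%E.
  apply: (poisson_independent NP (t := grid)) => //.
  by apply/nondecreasing_seqP => j; exact: ltW.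
have D_poisson j k : P (D j @^-1` [set k]) = (poisson_pmf (eps * lambda) k)%:E.
  by rewrite (poisson_increment NP k (grid_ge0 j) (grid_lt j)) gridS mulrC.
have [_ E] := walk_state_expectation
  (fun j => measurable_increment (grid j) (grid j.+1)) (mulr_gt0 eps0 lambda0)
  D_indep D_poisson psi n x z.
rewrite (_ : (fun w => _ * _) = fun w => path_amplitude psi n (D ^~ w) x z).
  rewrite E mulrA -rmorphM /= -expRM_natl -expRD.
  rewrite (_ : _ + _ = 0) ?expR0 ?mul1r// -mulr_natl /grid; ring.
apply/funext => w.
rewrite (path_amplitudeE _ _ _ (c := fun j => N (grid j) w)).
  rewrite [grid 0%N]mul0r (poisson_start NP) !subn0.
  by under [in RHS]eq_bigr do rewrite subn0.
by move=> j; apply: (poisson_nondecreasing NP) => //; exact: ltW.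
Qed.

(** A jump at t forces a jump in each interval from t - t / (k + 1) to t, which
    has probability at most lambda t / (k + 1). *)
Lemma ae_poisson_no_jump t : 0 < t ->
  {ae P, forall w, exists2 s, 0 <= s < t & N s w = N t w}.
Proof.
move=> t0.
pose s (k : nat) := t - t / k.+1%:R.
have s_ge0 k : 0 <= s k.
  by rewrite subr_ge0 ler_pdivrMr ?ltr0n// ler_peMr ?ler1n ?(ltW t0).
have s_lt k : s k < t by rewrite ltrBlDr ltrDl divr_gt0.
pose J k := (fun w => N t w - N (s k) w)%N @^-1` (~` [set 0%N]).
pose B := \bigcap_k J k.
exists B; split.
- by apply: bigcap_measurable => // k _; exact: measurable_increment.
- have PB k : (P B <= (lambda * t / k.+1%:R)%:E)%E.
    apply: (@le_trans _ _ (P (J k))).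
      apply: le_measure; rewrite ?inE.
      + by apply: bigcap_measurable => // j _; exact: measurable_increment.
      + exact: measurable_increment.
      + by move=> w; apply.
    rewrite /J -preimage_setC probability_setC;
      last exact: measurable_increment.
    rewrite (poisson_increment NP 0 (s_ge0 k) (s_lt k)) /s subKr.
    rewrite /poisson_pmf mulr_gt0 ?divr_gt0 ?ltr0n//=.
    rewrite expr0 mul1r invr1 mul1r -EFinB lee_fin lerBlDr -lerBlDl.
    by rewrite -mulrA (le_trans _ (expR_ge1Dx _)).
  apply/eqP; rewrite eq_le measure_ge0 andbT; apply/lee_addgt0Pr => e e0.
  rewrite add0e; apply: le_trans (PB (Num.truncn (lambda * t / e))) _.
  rewrite lee_fin ler_pdivrMr ?ltr0n// [leRHS]mulrC -ler_pdivrMr//.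
  by rewrite ltW// truncnS_gt.
- move=> w /= nw k _ /= Nsw; apply: nw.
  exists (s k); first by rewrite s_ge0 s_lt.
  have Nst := poisson_nondecreasing NP w (s_ge0 k) (ltW (s_lt k)).
  apply/eqP; rewrite eqn_leq Nst /=.
  by rewrite -subn_eq0; apply/eqP.
Qed.

End PoissonWalk.

(** * Convergence of the grid to continuous time *)

Section Grid.
Context {R : realType}.
Implicit Types (eps t y : R).

(** The last multiple of eps that does not exceed t. *)
Definition grid_time t eps : R := (Num.truncn (t / eps))%:R * eps.

Lemma grid_time_itv t eps : 0 <= t -> 0 < eps ->
  t - eps < grid_time t eps <= t.
Proof.
move=> t0 eps0.
have /andP[le lt] := truncn_itv (divr_ge0 t0 (ltW eps0)).
rewrite /grid_time -(ler_pdivlMr _ _ eps0) le andbT ltrBlDr.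
by move: lt; rewrite ltr_pdivrMr// -natr1 mulrDl mul1r.
Qed.

Lemma grid_time_cvg t : 0 <= t -> grid_time t eps @[eps --> 0^'+] --> t.
Proof.
move=> t0; apply/cvgrPdist_lt => e e0.
near=> eps.
have eps0 : 0 < eps by near: eps; exact: nbhs_right_gt.
have epse : eps < e by near: eps; exact: nbhs_right_lt.
have /andP[lt le] := grid_time_itv t0 eps0.
rewrite ger0_norm ?subr_ge0// (le_lt_trans _ epse)// lerBlDr -lerBlDl.
exact: ltW.
Unshelve. all: by end_near. Qed.

(** The rescaled site at which the initial state is read when the flips follow
    the path c. *)
Definition grid_position (c : R -> nat) t y (z : spin) eps : R :=
  eps * (Num.floor (y / eps) -
    sgn z * \sum_(j < Num.truncn (t / eps)) (-1) ^+ c (j%:R * eps))%:~R.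

Lemma grid_positionE c t y z eps : grid_position c t y z eps =
  eps * (Num.floor (y / eps))%:~R -
  (sgn z)%:~R *
    (eps * \sum_(j < Num.truncn (t / eps)) (-1) ^+ c (j%:R * eps)).
Proof.
rewrite /grid_position intrB intrM raddf_sum /= mulrBr; congr (_ - _).
rewrite mulrCA; congr (_ * (_ * _)); apply: eq_bigr => j _.
by rewrite rmorphXn rmorphN1.
Qed.

Lemma grid_position_cvg (c : R -> nat) t y (z : spin) :
  (forall s s', 0 <= s -> s <= s' -> (c s <= c s')%N) -> 0 <= t ->
  grid_position c t y z eps @[eps --> 0^'+] -->
  y - (sgn z)%:~R * \int[lebesgue_measure]_(s in `[0, t]) (-1) ^+ c s.
Proof.
move=> c_nd t0.
have floor_cvg : eps * (Num.floor (y / eps))%:~R @[eps --> 0^'+] --> y.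
  apply/cvgrPdist_lt => e e0; near=> eps.
  have eps0 : 0 < eps by near: eps; exact: nbhs_right_gt.
  have epse : eps < e by near: eps; exact: nbhs_right_lt.
  have /andP[] := floor_itv (y / eps).
  rewrite ler_pdivlMr// ltr_pdivrMr// intrD mulrDl mul1r => le lt.
  by rewrite [eps * _]mulrC ger0_norm ?subr_ge0//; lra.
have sum_cvg : eps * \sum_(j < Num.truncn (t / eps)) (-1) ^+ c (j%:R * eps)
    @[eps --> 0^'+] --> \int[lebesgue_measure]_(s in `[0, t]) (-1) ^+ c s.
  have K0 : 0 < 2 * (c t)%:R + 1 :> R by rewrite ltr_pwDr// mulr_ge0.
  apply/cvgrPdist_le => e e0; near=> eps.
  have eps0 : 0 < eps by near: eps; exact: nbhs_right_gt.
  have /andP[lt le] := grid_time_itv t0 eps0.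
  rewrite distrC; apply: le_trans (riemann_sum_error c_nd (ltW eps0) le) _.
  have epse : eps * (2 * (c t)%:R + 1) <= e.
    rewrite -ler_pdivlMr//.
    by near: eps; apply: nbhs_right_le; rewrite divr_gt0.
  apply: le_trans epse; rewrite mulrDr mulr1 mulrCA mulrA lerD//.
    apply: ler_wpM2l; first by rewrite mulr_ge0// ltW.
    by rewrite ler_nat c_nd// mulr_ge0// ltW.
  by rewrite lerBlDr -lerBlDl ltW.
have zsum_cvg : (sgn z)%:~R *
      (eps * \sum_(j < Num.truncn (t / eps)) (-1) ^+ c (j%:R * eps))
    @[eps --> 0^'+] -->
    (sgn z)%:~R * \int[lebesgue_measure]_(s in `[0, t]) (-1) ^+ c s.
  by apply: cvgM; [exact: cvg_cst|exact: sum_cvg].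
apply: cvg_trans (cvgB floor_cvg zsum_cvg).
by apply: near_eq_cvg; apply: nearW => eps; rewrite grid_positionE.
Unshelve. all: by end_near. Qed.

End Grid.

(** * The continuum limit *)

Section MeasurablePosition.
Context {d : measure_display} {T : measurableType d} {R : realType}.
Variables (P : probability T R) (N : R -> {RV P >-> nat}).

Lemma measurable_grid_position (t y : R) (z : spin) (eps : R) :
  measurable_fun setT (fun w => grid_position (N ^~ w) t y z eps).
Proof.
under eq_fun do rewrite grid_positionE.
apply: measurable_funB; first exact: measurable_cst.
do 2 (apply: measurable_funM; first exact: measurable_cst).
apply: measurable_sum => j.
have ms : measurable_fun setT (fun k : nat => (-1) ^+ k : R) by move=> _ B _.
exact: (measurableT_comp ms (measurable_funP _)).
Qed.

(** The path integral is measurable in the sample because it is a pointwise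
    limit of its Riemann sums, which involve finitely many times only. *)
Lemma measurable_position (lambda t y : R) (z : spin) :
  poisson_process lambda N -> 0 <= t ->
  measurable_fun setT (position N y z t).
Proof.
move=> NP t0; apply: (measurable_fun_cvg
  (h := fun n w => grid_position (N ^~ w) t y z n.+1%:R^-1)).
  by move=> n; exact: measurable_grid_position.
move=> w _; have /cvg_at_rightP := @grid_position_cvg _ (N ^~ w) t y z
  (poisson_nondecreasing NP w) t0.
by apply; split=> [n|]; [rewrite invr_gt0|exact: cvg_harmonic].
Qed.

End MeasurablePosition.

Theorem theorem4p2 (R : realType) (lambda : R) (f : R -> spin -> C R)
    (psi0 : R -> l2 R)
    (d : measure_display) (T : measurableType d) (P : probability T R)
    (N : R -> {RV P >-> nat}) :
  0 < lambda ->
  (forall z, continuous (f ^~ z)) ->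
  (forall z, `|f y z| @[y --> +oo%R] --> (0 : C R)) ->
  (forall z, `|f y z| @[y --> -oo%R] --> (0 : C R)) ->
  (forall eps, 0 < eps -> forall x z, psi0 eps (x, z) = f (eps * x%:~R) z) ->
  poisson_process lambda N ->
  forall (t y : R) (z : spin), 0 < t ->
    let X (w : T) : C R :=
      ('i%C : C R) ^+ N t w * f (position N y z t w) (flip (N t w) z) in
    cintegrable P X /\
    (walk_state (exp_sigma1 (eps * lambda)) (psi0 eps)
       (Num.truncn (t / eps)) (Num.floor (y / eps), z)
       @[eps --> 0^'+] --> ((expR (lambda * t))%:C%C : C R) * cexpectation P X).
Proof.
move=> lambda0 cf fp fm psi0E NP t y z t0 X.
have [M fM] : exists M, forall y z, Normc.normc (f y z) <= M.
  have [M0 fM0] := normc_vanishing_bounded (cf ord0) (fp ord0) (fm ord0).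
  have [M1 fM1] := normc_vanishing_bounded (cf (lift ord0 ord0))
    (fp (lift ord0 ord0)) (fm (lift ord0 ord0)).
  exists (Num.max M0 M1) => y' z'; rewrite le_max.
  have [->|->] : z' = ord0 \/ z' = lift ord0 ord0.
  - by case: z' => [[|[|]]// ?]; [left|right]; apply/val_inj.
  - by rewrite fM0.
  - by rewrite fM1 orbT.
have mN s : measurable_fun setT (N s) by exact: measurable_funP.
have iX : cintegrable P X.
  apply: cintegrable_phase fM _ _ => //.
  exact: measurable_position NP (ltW t0).
split=> //.
pose Y (eps : R) w : R := grid_position (N ^~ w) t y z eps.
pose X_ eps w : C R := 'i%C ^+ N (grid_time t eps) w *
  f (Y eps w) (flip (N (grid_time t eps) w) z).
have walkE eps : 0 < eps ->
    walk_state (exp_sigma1 (eps * lambda)) (psi0 eps)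
      (Num.truncn (t / eps)) (Num.floor (y / eps), z) =
    (expR (lambda * grid_time t eps))%:C%C * cexpectation P (X_ eps).
  move=> eps0; rewrite (walk_state_poisson lambda0 NP)//; congr (_ * _).
  by congr (cexpectation P _); apply/funext => w; rewrite psi0E.
have X_cvg : cexpectation P (X_ eps) @[eps --> 0^'+] --> cexpectation P X.
  apply: (cexpectation_dominated (M := M)) => //.
  - move=> e e0; apply: cintegrable_phase fM _ _ => //.
    exact: measurable_grid_position.
  - by move=> e w e0; rewrite /X_ Normc.normcM normc_iX mul1r.
  - have := ae_poisson_no_jump lambda0 NP t0.
    apply: filterS => w [s /andP[s0 st] Nst].
    have c_nd : forall s s', 0 <= s -> s <= s' -> (N s w <= N s' w)%N.
      by move=> ? ?; exact: poisson_nondecreasing NP w _ _.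
    have Ycvg : Y eps w @[eps --> 0^'+] --> position N y z t w.
      exact: (@grid_position_cvg _ (N ^~ w) t y z c_nd (ltW t0)).
    have : 'i%C ^+ N t w * f (Y eps w) (flip (N t w) z)
        @[eps --> 0^'+] --> X w.
      apply: cvgM; first exact: cvg_cst.
      exact: (cvg_comp _ _ Ycvg (cf _ _)).
    apply: cvg_trans; apply: near_eq_cvg; near=> eps.
    have eps0 : 0 < eps by near: eps; exact: nbhs_right_gt.
    (* Once eps <= t - s, the last grid time lies between s and t. *)
    have epss : eps <= t - s.
      by near: eps; apply: nbhs_right_le; rewrite subr_gt0.
    have /andP[lt le] := grid_time_itv (ltW t0) eps0.
    have sg : s <= grid_time t eps.
      by rewrite (le_trans _ (ltW lt))// lerBrDr addrC -lerBrDr.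
    rewrite /X_; suff -> : N (grid_time t eps) w = N t w by [].
    apply/eqP; rewrite eqn_leq c_nd ?(le_trans s0)//= -Nst c_nd//.
have E_cvg : (expR (lambda * grid_time t eps))%:C%C
    @[eps --> 0^'+] --> ((expR (lambda * t))%:C%C : C R).
  apply: cvg_complex => /=; last exact: cvg_cst.
  have lt_cvg : lambda * grid_time t eps @[eps --> 0^'+] --> lambda * t.
    by apply: cvgM; [exact: cvg_cst|exact: grid_time_cvg (ltW t0)].
  exact: (cvg_comp _ _ lt_cvg (@continuous_expR R _)).
apply: cvg_trans (cvgM E_cvg X_cvg).
apply: near_eq_cvg; near=> eps.
by rewrite walkE//; near: eps; exact: nbhs_right_gt.
Unshelve. all: by end_near.
Qed.
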